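(* Let $\mathcal{H}$ be a complex Hilbert space and let $S,T\in\mathcal{L}(\mathcal{H})$ be closed range operators such that $S=TW$ for some unitary operator $W\in\mathcal{L}(\mathcal{H})$. If $T=U-V$ is a proper splitting of $T$, then $S=UW-VW$ is a proper splitting of $S$. Moreover, the proper splitting $T=U-V$ of $T$ converges if and only if the proper splitting $S=UW-VW$ converges.
   Context: A proper splitting of a closed range operator $A\in\mathcal{L}(\mathcal{H})$ is a decomposition $A=U-V$ with $U,V\in\mathcal{L}(\mathcal{H})$, $\mathcal{R}(U)=\mathcal{R}(A)$ and $\mathcal{N}(U)=\mathcal{N}(A)$; it converges if $\rho(U^\dagger V)<1$, where $\rho$ is the spectral radius and $U^\dagger$ the Moore-Penrose inverse. *)

(* Defs.v *)
From HB Require Import structures.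
From mathcomp Require Import all_boot all_order all_algebra.
From mathcomp Require Import complex.
From mathcomp Require Import all_classical all_reals all_analysis.

Set Implicit Arguments.
Unset Strict Implicit.
Unset Printing Implicit Defensive.

Import Order.TTheory GRing.Theory Num.Theory.
Import numFieldNormedType.Exports.

Local Open Scope classical_set_scope.
Local Open Scope complex_scope.
Local Open Scope ring_scope.

(* Inner products are linear in the first argument and conjugate-linear in the
   second. *)
HB.mixin Record NormedModule_isHilbert (R : realType) H
    & CompleteNormedModule R[i] H := {
  inner : {dot H for Num.conj} ;
  inner_normE : forall x : H, inner x x = `|x| ^+ 2 ;
}.

#[short(type="hilbertType")]
HB.structure Definition Hilbert (R : realType) :=
  {H of CompleteNormedModule R[i] H & NormedModule_isHilbert R H}.

(* The bounded operators: for linear maps continuity and boundedness coincide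
   (linear_bounded_continuous). *)
#[short(type="boundedOp")]
HB.structure Definition BoundedOp (K : numFieldType) (V : normedModType K) :=
  {f of @isContinuous V V f & @GRing.Linear K V V *:%R f}.

HB.instance Definition _ (K : numFieldType) (V : normedModType K) :=
  gen_eqMixin (boundedOp V).
HB.instance Definition _ (K : numFieldType) (V : normedModType K) :=
  gen_choiceMixin (boundedOp V).

Section bounded_operators.
Context {K : numFieldType} {E : normedModType K}.
Implicit Types (A B U V : boundedOp E) (a : K).

Lemma boundedOp_continuous A : continuous A.
Proof. exact: cts_fun. Qed.

Lemma boundedOp_eqP A B : A = B <-> A =1 B.
Proof.
case: A B => [a [[a1] [a2] [a3]]] [b [[b1] [b2] [b3]]]; split=> [-> //|/= /funext e].
by subst b; congr BoundedOp.Pack; congr BoundedOp.Class;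
  [congr isContinuous.Axioms_ | congr GRing.isNmodMorphism.Axioms_ |
   congr GRing.isScalable.Axioms_]; exact: Prop_irrelevance.
Qed.

HB.instance Definition _ := isContinuous.Build E E idfun (fun x => cvg_id).

Let zero_continuous : continuous (\0 : E -> E).
Proof. exact: cst_continuous. Qed.
HB.instance Definition _ := isContinuous.Build E E (\0 : E -> E) zero_continuous.

Let sub_continuous A B : continuous (A \- B).
Proof. by move=> x; apply: cvgB; exact: boundedOp_continuous. Qed.
HB.instance Definition _ A B :=
  isContinuous.Build E E (A \- B) (@sub_continuous A B).

Let scale_continuous a A : continuous (a \*: A).
Proof. by move=> x; apply: cvgZr; exact: boundedOp_continuous. Qed.
HB.instance Definition _ a A :=
  isContinuous.Build E E (a \*: A) (@scale_continuous a A).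

HB.instance Definition _ A B := isContinuous.Build E E (A \o B)
  (fun x => continuous_comp (@boundedOp_continuous B x)
                            (@boundedOp_continuous A (B x))).

Definition nullspace A : set E := [set x | A x = 0].

Definition closed_range A := closed (range A).

Definition invertible_op A := exists B, cancel A B /\ cancel B A.

Definition spectrum A : set K := [set l | ~ invertible_op (A \- l \*: idfun)].

Definition proper_splitting A U V :=
  [/\ A =1 U \- V, range U = range A & nullspace U = nullspace A].

End bounded_operators.

(* In the zero space the spectrum is empty and, as [sup set0 = 0], the spectral
   radius is 0; otherwise the spectrum is nonempty and bounded. *)
Definition spectral_radius (R : realType) (H : hilbertType R)
    (A : boundedOp H) : R :=
  sup [set ComplexField.Normc.normc l | l in spectrum A].

Section hilbert_operators.
Context {R : realType} {H : hilbertType R}.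
Implicit Types A B X U V W : boundedOp H.

Definition is_adjoint A B := forall x y, inner (A x) y = inner x (B y).

Definition unitary_op W :=
  exists W', [/\ is_adjoint W W', cancel W W' & cancel W' W].

Definition penrose A X :=
  [/\ A \o X \o A =1 A, X \o A \o X =1 X,
      is_adjoint (A \o X) (A \o X) & is_adjoint (X \o A) (X \o A)].

(* The solution of the Penrose equations in L(H), which exists exactly when A
   has closed range; the default value 0 only concerns the other operators. *)
Definition mp_inverse A : boundedOp H := xget (\0 : boundedOp H) (penrose A).

Lemma inner_inj (x y : H) : (forall z, inner x z = inner y z) -> x = y.
Proof.
move=> e; apply/eqP; rewrite -subr_eq0 -normr_eq0 -sqrf_eq0 -inner_normE.
by rewrite linearBl /= e subrr.
Qed.

Lemma penrose_unique A X Y : penrose A X -> penrose A Y -> X = Y.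
Proof.
move=> [AXA XAX aAX aXA] [AYA YAY aAY aYA].
have eAXY u : A (X u) = A (Y u).
  apply: inner_inj => z; rewrite -[in LHS](AYA (X u)).
  by rewrite [LHS]aAY [LHS]aAX /= [A (X _)]AXA -aAY.
have eXYA u : X (A u) = Y (A u).
  apply: inner_inj => z; rewrite -[in LHS](AYA u).
  by rewrite [LHS]aXA [LHS]aYA /= [A (X _)]AXA -aYA.
apply/boundedOp_eqP => u.
by rewrite -[LHS]XAX /= eAXY eXYA [LHS]YAY.
Qed.

Definition splitting_converges U V :=
  spectral_radius (mp_inverse U \o V : boundedOp H) < 1.

End hilbert_operators.

(* Main.v *)
Require Import Defs.
From mathcomp Require Import all_boot all_order all_algebra.
From mathcomp Require Import complex.
From mathcomp Require Import all_classical all_reals all_analysis.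

(** Unitary invariance of the Penrose equations gives
    [(U W)^dagger = W^* U^dagger], hence
    [(U W)^dagger (V W) = W^* (U^dagger V) W]: the iteration operators of the two
    splittings are similar and have the same spectrum. *)

Import GRing.Theory.
Local Open Scope classical_set_scope.
Local Open Scope ring_scope.

Section similarity.
Context {K : numFieldType} {E : normedModType K}.
Implicit Types A B P Q S T U V : boundedOp E.

Lemma invertible_op_similar A B P Q : cancel P Q -> cancel Q P ->
  B =1 Q \o A \o P -> invertible_op A -> invertible_op B.
Proof.
move=> PK QK BE [C [AC CA]]; exists (Q \o C \o P : boundedOp E).
by split=> x; rewrite /= BE /= QK (AC, CA) (PK, QK).
Qed.

(** Conjugation by [P] fixes scalar operators, so [B - l] is similar to [A - l] for each [l];
    exchanging [P] and [Q] gives the other inclusion. *)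
Lemma spectrum_similar A B P Q : cancel P Q -> cancel Q P ->
  B =1 Q \o A \o P -> spectrum B = spectrum A.
Proof.
move=> PK QK BE; apply/seteqP; split=> l /=; apply: contra_not.
  apply: (@invertible_op_similar _ _ P Q) => // x /=.
  by rewrite BE /= [RHS]linearB /= [Q (_ *: _)]linearZ /= PK.
apply: (@invertible_op_similar _ _ Q P) => // x /=.
by rewrite BE /= [RHS]linearB /= [P (_ *: _)]linearZ /= !QK.
Qed.

Lemma range_comp_can {X Y Z : Type} (f : Y -> Z) (g : X -> Y) (h : Y -> X) :
  cancel h g -> range (f \o g) = range f.
Proof.
move=> hK; apply/seteqP; split=> _ [x _ <-]; first by exists (g x).
by exists (h x) => //=; rewrite hK.
Qed.

(** The right inverse [Q] makes [P] surjective, so composing with [P] keeps ranges; null spaces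
    become preimages under [P]. *)
Lemma proper_splitting_comp_can S T U V P Q : cancel Q P -> S =1 T \o P ->
  proper_splitting T U V -> proper_splitting S (U \o P) (V \o P).
Proof.
move=> QK SE [TE rUT nUT]; split=> [x||].
- by rewrite SE /= TE.
- by rewrite (funext SE) !(range_comp_can _ _ _ QK).
- apply/funext => x; rewrite [RHS]/nullspace /mkset SE.
  by rewrite -[RHS]/(nullspace T (P x)) -nUT.
Qed.

End similarity.

Section unitary_invariance.
Context {R : realType} {H : hilbertType R}.
Implicit Types U V W X : boundedOp H.

Lemma is_adjoint_inverse W W' : is_adjoint W W' -> cancel W W' ->
  cancel W' W -> is_adjoint W' W.
Proof. by move=> adj WK W'K x y; rewrite -{2}[x]W'K adj WK. Qed.

(** One product collapses to [U \o X]; the other is [X \o U] conjugated by a unitary, hence still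
    self-adjoint. *)
Lemma penrose_comp_unitary U W W' X : is_adjoint W W' -> cancel W W' ->
  cancel W' W -> penrose U X -> penrose (U \o W) (W' \o X).
Proof.
move=> adj WK W'K [UXU XUX aUX aXU].
have adj' := is_adjoint_inverse _ _ adj WK W'K.
split=> [x|x|x y|x y] /=; rewrite ?W'K.
- exact: UXU.
- by congr (W' _); exact: XUX.
- exact: aUX.
- by rewrite adj' -adj; exact: aXU.
Qed.

(* When [U] has no Moore-Penrose inverse, neither has [U \o W], and both sides
   are the default value 0. *)
Lemma mp_inverse_comp_unitary U W W' : is_adjoint W W' -> cancel W W' ->
  cancel W' W -> mp_inverse (U \o W) = (W' \o mp_inverse U : boundedOp H).
Proof.
move=> adj WK W'K; rewrite {2}/mp_inverse; case: xgetP => [X _ pX|noX].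
  (* Both sides solve the Penrose equations of [U \o W]. *)
  apply: (@penrose_unique _ _ (U \o W)); last exact: penrose_comp_unitary.
  by apply: (xgetPex _ (ex_intro _ (W' \o X : boundedOp H) _));
     exact: penrose_comp_unitary.
rewrite /mp_inverse; case: xgetP => [Y _ pY|_]; last first.
  by apply/boundedOp_eqP => x /=; rewrite linear0.
(* Undoing [W] by the unitary [W'] turns a solution [Y] for [U \o W] into the solution [W \o Y] for
   [U], a contradiction. *)
have UE : ((U \o W : boundedOp H) \o W' : boundedOp H) = U.
  by apply/boundedOp_eqP => x /=; rewrite W'K.
case: (noX (W \o Y)); rewrite -UE.
by apply: penrose_comp_unitary => //; exact: is_adjoint_inverse.
Qed.

Lemma spectral_radius_comp_unitary U V W : unitary_op W ->
  spectral_radius (mp_inverse (U \o W) \o (V \o W)) =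
  spectral_radius (mp_inverse U \o V).
Proof.
move=> [W' [adj WK W'K]]; rewrite /spectral_radius.
rewrite (mp_inverse_comp_unitary _ _ _ adj WK W'K).
by rewrite (spectrum_similar (mp_inverse U \o V) _ _ _ WK W'K).
Qed.

End unitary_invariance.

Theorem proposition7p2 (R : realType) (H : hilbertType R) (S T W : boundedOp H)
  (closedS : closed_range S) (closedT : closed_range T)
  (unitaryW : unitary_op W) (STW : S =1 T \o W)
  (U V : boundedOp H) (splitT : proper_splitting T U V) :
  proper_splitting S (U \o W) (V \o W) /\
  (splitting_converges U V <-> splitting_converges (U \o W) (V \o W)).
Proof.
split.
  by case: unitaryW => W' [_ _ W'K]; exact: proper_splitting_comp_can W'K STW splitT.
by rewrite /splitting_converges spectral_radius_comp_unitary.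
Qed.
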